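(* Let $F$ be a distribution function on $\mathbb{R}$ with probability density function $f$, let $N$ be a random variable with values in $\mathbb{N}_1=\{1,2,\dots\}$, and let $i\in\mathbb{N}_1$ with $P(N-1\ge i)>0$. Then the density $f_{i:\rho(N)}$ of the $i$th order statistic with random sample size $\rho(N)=N-1$ is $$f_{i:\rho(N)}(x)=\frac{(-1)^{i}F^{i-1}(x)f(x)}{\pi_N^{i}\,(i-1)!}\,\mathcal{L}_N^{(i)}(F(x)),\qquad x\in\mathbb{R}.$$
   Context: Write $P_N(k)=P(N=k)$, $\rho(k)=k-1$, and $\pi_N^i=P(N\ge i)$. The nabla Laplace transform of $N$ is $\mathcal{L}_N(t)=\sum_{k=1}^{\infty}(1-t)^{k-1}P_N(k)$ and $\mathcal{L}_N^{(i)}$ is its $i$th derivative in $t$. The distribution function of the $i$th order statistic with random sample size $\rho(N)$ is, by definition, $$F_{i:\rho(N)}(x)=\frac{1}{\pi_N^i}\sum_{k=i}^{\infty}F_{i:\rho(k)}(x\mid k)\,P_N(k),$$ where $F_{i:\rho(k)}(x\mid k)=\sum_{j=i}^{\rho(k)}\binom{\rho(k)}{j}F^j(x)(1-F(x))^{\rho(k)-j}$ is the distribution function of the $i$th order statistic of an iid sample of size $\rho(k)$ from $F$ (an empty sum is $0$). $f_{i:\rho(N)}$ denotes the density corresponding to $F_{i:\rho(N)}$. *)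

(* Defs.v *)
From HB Require Import structures.
From mathcomp Require Import all_boot all_order all_algebra.
From mathcomp Require Import all_classical all_reals all_analysis.

Set Implicit Arguments.
Unset Strict Implicit.
Unset Printing Implicit Defensive.

Import Order.TTheory GRing.Theory Num.Theory.
Import numFieldNormedType.Exports.

Local Open Scope classical_set_scope.
Local Open Scope ring_scope.

(* The subtraction is truncated, but rho is only relevant on k >= 1. *)
Definition rho (k : nat) : nat := (k - 1)%N.

(* P(N = k), as a real number *)
Definition prob_eq d (T : measurableType d) (R : realType)
    (P : probability T R) (N : {RV P >-> nat}) (k : nat) : R :=
  fine (P [set w | N w = k]).

(* pi_N^i = P(N >= i), as a real number *)
Definition prob_ge d (T : measurableType d) (R : realType)
    (P : probability T R) (N : {RV P >-> nat}) (i : nat) : R :=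
  fine (P [set w | (i <= N w)%N]).

(* The series converges for t in [0, 2]; elsewhere it may diverge, and the
   value is then the default value of limn.  The points t in ]0, 1] are
   interior to [0, 2], so the two-sided derivatives there are the genuine ones.
   At t = 0 a derivative need not exist (it does not when N has no finite
   moment of the corresponding order); t = F x = 0 only occurs on a set where
   any density of F vanishes almost everywhere. *)
Definition nabla_laplace d (T : measurableType d) (R : realType)
    (P : probability T R) (N : {RV P >-> nat}) (t : R) : R :=
  limn (fun n => \sum_(1 <= k < n) ((1 - t) ^+ (k - 1)%N * prob_eq N k)).

(* cdf of the i-th order statistic of an iid sample of size n from F; the sum
   is empty, hence 0, when n < i *)
Definition order_stat_cdf (R : realType) (F : R -> R) (i n : nat) (x : R) : R :=
  \sum_(i <= j < n.+1) ('C(n, j)%:R * F x ^+ j * (1 - F x) ^+ (n - j)%N).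

(* F_{i:rho(N)}.  The normalisation is by P(N >= i), not by P(rho(N) >= i), so
   the limit of this function at +oo may be less than 1. *)
Definition random_order_stat_cdf d (T : measurableType d) (R : realType)
    (P : probability T R) (F : R -> R) (N : {RV P >-> nat}) (i : nat) (x : R)
    : R :=
  (prob_ge N i)^-1 *
  limn (fun n =>
    \sum_(i <= k < n) (order_stat_cdf F i (rho k) x * prob_eq N k)).

(* g is a density of the function G, with respect to Lebesgue measure.  Total
   mass 1 is not part of the definition: it follows when G tends to 1 at +oo. *)
Definition is_density (R : realType) (G g : R -> R) : Prop :=
  [/\ measurable_fun [set: R] g,
      forall x, 0 <= g x &
      forall x, (G x)%:E
        = (\int[@lebesgue_measure R]_(y in `]-oo, x]) (g y)%:E)%E].

(* Main.v *)
Require Import Defs.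
From HB Require Import structures.
From mathcomp Require Import all_boot all_order all_algebra.
From mathcomp Require Import all_classical all_reals all_analysis.
From mathcomp Require Import measurable_realfun.
From mathcomp Require Import ring lra.

Import Order.TTheory GRing.Theory Num.Theory.
Import numFieldNormedType.Exports.

Local Open Scope classical_set_scope.
Local Open Scope ring_scope.

(** If [F] has density [f], Tonelli's theorem gives the product rule for
    densities, hence [F ^+ n.+1] has density [n.+1 * F ^+ n * f], and by linearity
    [q(F) - q(0)] is the integral of [q'(F) * f] for every polynomial [q].  For a
    fixed sample size [n] the distribution function of the order statistic is
    [q(F)] with [q] a binomial tail, whose derivative telescopes to
    [n * C(n-1, i-1) * t^(i-1) * (1-t)^(n-i)].  Summing over the values of [N] by
    monotone convergence produces the power series of the [i]-th derivative of
    the Laplace transform, differentiated termwise on [0 < t < 2].  The series may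
    diverge at [t = 0], but [f] vanishes almost everywhere on [F = 0]; at such
    points only the sign of the formula matters. *)

(** * Densities: uniqueness and elementary properties *)

Lemma is_density_integrable {R : realType} (G g : R -> R) :
  is_density G g -> forall x, (@lebesgue_measure R).-integrable `]-oo, x] (EFin \o g).
Proof.
move=> [mg g0 Gg] x; apply/integrableP; split.
  by apply/measurable_EFinP; exact: measurable_funTS.
under eq_integral do rewrite /= ger0_norm//.
by rewrite -Gg ltry.
Qed.

(** By Lebesgue differentiation the derivative of [G] agrees almost everywhere with each of its
    densities. *)
Lemma is_density_ae_unique {R : realType} (G g h : R -> R) :
  is_density G g -> is_density G h ->
  {ae @lebesgue_measure R, forall x, g x = h x}.
Proof.
suff D k : is_density G k ->
    {ae @lebesgue_measure R, forall x, derive1 G x = k x}.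
  move=> /D Dg /D Dh; apply: filterS2 Dg Dh.
    exact: (ae_filter_ringOfSetsType lebesgue_measure).
  by move=> x <- <-.
move=> Gk; have [mk k0 Gint] := Gk.
have ik := is_density_integrable _ _ Gk.
have lk : locally_integrable [set: R] k.
  split => //; first exact: openT.
  (* A compact set lies in some half-line []-oo, M + 1]], where [k] is already integrable. *)
  move=> K _ cK; have [M [_ /(_ (M + 1))KM]] := compact_bounded cK.
  have /integrableP[_] := ik (M + 1); apply: le_lt_trans.
  apply: ge0_subset_integral => //=.
  - exact: compact_measurable.
  - by apply/measurable_EFinP/measurableT_comp => //; exact: measurable_funTS.
  - move=> x Kx /=; rewrite in_itv/= (le_trans (ler_norm x))//.
    by apply: KM => //; rewrite ltrDl.
have := FTC1Ny ik lk; apply: filterS.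
  exact: (ae_filter_ringOfSetsType lebesgue_measure).
move=> x [_ <-]; congr (derive1 _ x); apply/funext => y.
by rewrite /Rintegral -Gint.
Qed.

Lemma is_density_ge0 {R : realType} (G g : R -> R) :
  is_density G g -> forall x, 0 <= G x.
Proof.
move=> [mg g0 Gg] x; rewrite -lee_fin Gg; apply: integral_ge0 => y _.
by rewrite lee_fin.
Qed.

Lemma is_density_integral_cc {R : realType} (G g : R -> R) (y x : R) :
  is_density G g -> y <= x ->
  (\int[@lebesgue_measure R]_(z in `[y, x]) (g z)%:E)%E = (G x - G y)%:E.
Proof.
move=> [mg g0 Gg] yx.
have mE (D : set R) : measurable_fun D (EFin \o g).
  by apply/measurable_EFinP; exact: measurable_funTS.
have := Gg x; rewrite (_ : [set` `]-oo, x]] = `]-oo, y[ `|` `[y, x]); last first.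
  apply/seteqP; split => z /=; rewrite !in_itv/=.
    by case: (ltP z y) => //= zy zx; [left|right].
  by case => [/ltW/le_trans|/andP[]]; first apply.
rewrite ge0_integral_setU//=; last 3 first.
- exact: mE.
- by move=> z _; rewrite lee_fin.
- by apply/disj_setPS => z [] /=; rewrite !in_itv/= => zy /andP[]; rewrite leNgt zy.
rewrite integral_itv_bndo_bndc// -Gg EFinB => ->.
by rewrite [X in (X - _)%E]addeC addeK.
Qed.

Lemma is_density_nondecreasing {R : realType} (G g : R -> R) :
  is_density G g -> {homo G : x y / x <= y}.
Proof.
move=> Gg x y xy; rewrite -subr_ge0 -lee_fin -(is_density_integral_cc _ _ _ _ Gg xy).
by have [_ g0 _] := Gg; apply: integral_ge0 => z _; rewrite lee_fin.
Qed.

Lemma is_density_measurable {R : realType} (G g : R -> R) (D : set R) :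
  is_density G g -> measurable_fun D G.
Proof.
move=> Gg; apply: measurable_funTS; apply: nondecreasing_measurable => //.
exact: is_density_nondecreasing Gg.
Qed.

(** * Products, powers and polynomials of distribution functions *)

(* Both sides are the integral of [f y * g z] over [y <= z <= x]. *)
Lemma is_density_integral_swap {R : realType} (F f G g : R -> R) (x : R) :
  is_density F f -> is_density G g ->
  (\int[@lebesgue_measure R]_(z in `]-oo, x]) (g z * F z)%:E =
   \int[@lebesgue_measure R]_(y in `]-oo, x]) (f y * (G x - G y))%:E)%E.
Proof.
move=> Ff Gg; have [mf f0 fF] := Ff; have [mg g0 gG] := Gg.
pose mu := @lebesgue_measure R.
pose A := [set q : R * R | q.1 <= q.2].
have inA y z : ((y, z) \in A) = (y <= z) by apply/idP/idP; rewrite inE.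
have inI (t z : R) : (z \in [set` `]-oo, t]]) = (z <= t) by rewrite mem_setE in_itv.
(* The indicators impose [y <= z] and [z <= x], which together force [y <= x]. Integrating out [y]
   leaves [g z * F z]; integrating out [z] leaves [f y * (G x - G y)]. *)
pose k (p : R * R) : \bar R :=
  (f p.1 * g p.2 * \1_A p * \1_`]-oo, x] p.2)%:E.
have k0 p : (0 <= k p)%E by rewrite /k lee_fin !mulr_ge0.
have mk : measurable_fun setT k.
  apply/measurable_EFinP; apply: measurable_funM; last first.
    by apply: measurableT_comp => //; exact: measurable_indic.
  apply: measurable_funM; first by apply: measurable_funM; exact: measurableT_comp.
  apply: measurable_indic.
  rewrite -[X in measurable X]setTI; exact: measurable_fun_le.
have mE (D : set R) (h : R -> R) : measurable_fun setT h ->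
    measurable_fun D (fun x => (h x)%:E).
  by move=> mh; apply/measurable_EFinP; exact: measurable_funTS.
have kz z : (\int[mu]_y k (y, z) = ((fun z => (g z * F z)%:E) \_ `]-oo, x]) z)%E.
  rewrite patchE inI; case: (leP z x) => zx.
    rewrite EFinM fF -ge0_integralZl//; last 3 first.
    - exact: mE.
    - by move=> ? _; rewrite lee_fin.
    - by rewrite lee_fin.
    rewrite [RHS]integral_mkcond; apply: eq_integral => y _.
    rewrite patchE /k /= !indicE inI zx mulr1 inA inI.
    by case: (leP y z) => yz; rewrite ?mulr0 ?mulr1// mulrC.
  rewrite (_ : (fun y => k (y, z)) = cst 0%E) ?integral0//; apply/funext => y.
  by rewrite /k /= !indicE inA inI (leNgt z x) zx mulr0.
have ky y : (\int[mu]_z k (y, z) = ((fun y => (f y * (G x - G y))%:E) \_ `]-oo, x]) y)%E.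
  rewrite patchE inI; case: (leP y x) => yx.
    rewrite EFinM -(is_density_integral_cc _ _ _ _ Gg)// -ge0_integralZl//; last 3 first.
    - exact: mE.
    - by move=> ? _; rewrite lee_fin.
    - by rewrite lee_fin.
    rewrite [RHS]integral_mkcond; apply: eq_integral => z _.
    rewrite patchE /k /= !indicE inA inI mem_setE in_itv/=.
    by case: (leP y z) => yz; case: (leP z x) => zx; rewrite ?(mulr1, mulr0)// EFinM.
  rewrite (_ : (fun z => k (y, z)) = cst 0%E) ?integral0//; apply/funext => z.
  rewrite /k /= !indicE inA inI.
  case: (leP y z) => yz; rewrite ?(mulr0, mul0r)//.
  case: (leP z x) => zx; rewrite ?mulr0//.
  by rewrite ltNge (le_trans yz zx) in yx.
rewrite integral_mkcond [RHS]integral_mkcond.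
under eq_integral do rewrite -kz.
under [RHS]eq_integral do rewrite -ky.
by rewrite -fubini_tonelli.
Qed.

(** After the swap, the two integrands [f y * G y] and [f y * (G x - G y)] add up to [f y] times the
    constant [G x]. *)
Lemma is_density_mul {R : realType} (F f G g : R -> R) :
  is_density F f -> is_density G g ->
  is_density (fun x => F x * G x) (fun x => f x * G x + g x * F x).
Proof.
move=> Ff Gg; have [mf f0 fF] := Ff; have [mg g0 gG] := Gg.
have F0 := is_density_ge0 _ _ Ff; have G0 := is_density_ge0 _ _ Gg.
have mF := is_density_measurable _ _ setT Ff.
have mG := is_density_measurable _ _ setT Gg.
have mE (D : set R) (h : R -> R) : measurable_fun setT h ->
    measurable_fun D (fun x => (h x)%:E).
  by move=> mh; apply/measurable_EFinP; exact: measurable_funTS.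
split.
- by apply: measurable_funD; exact: measurable_funM.
- by move=> x; rewrite addr_ge0// mulr_ge0.
move=> x; under eq_integral do rewrite EFinD.
have fGx y : y \in [set` `]-oo, x]] -> 0 <= f y * (G x - G y).
  rewrite mem_setE in_itv/= => yx; rewrite mulr_ge0// subr_ge0.
  exact: is_density_nondecreasing Gg _ _ yx.
rewrite ge0_integralD//=; last 4 first.
- by move=> y _; rewrite lee_fin mulr_ge0.
- by apply: mE; exact: measurable_funM.
- by move=> y _; rewrite lee_fin mulr_ge0.
- by apply: mE; exact: measurable_funM.
rewrite (is_density_integral_swap _ _ _ _ _ Ff Gg) -ge0_integralD//=; last 4 first.
- by move=> y _; rewrite lee_fin mulr_ge0.
- by apply: mE; exact: measurable_funM.
- by move=> y yx; rewrite lee_fin fGx// inE.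
- by apply: mE; apply: measurable_funM => //; exact: measurable_funB.
under eq_integral do rewrite -EFinD -mulrDr addrC subrK mulrC EFinM.
by rewrite ge0_integralZl ?lee_fin//= -?fF ?EFinM 1?muleC//;
  [exact: mE|move=> ? _; rewrite lee_fin].
Qed.

(** Induction with the product rule. The exponent starts at 1 because the constant function 1 has no
    density. *)
Lemma is_density_exp {R : realType} (F f : R -> R) (n : nat) :
  is_density F f ->
  is_density (fun x => F x ^+ n.+1) (fun x => n.+1%:R * F x ^+ n * f x).
Proof.
move=> Ff; elim: n => [|n IH].
  by under eq_fun do rewrite expr1; under [X in is_density _ X]eq_fun do rewrite expr0 !mul1r.
have := is_density_mul _ _ _ _ Ff IH.
under eq_fun do rewrite -exprS.
congr is_density; apply/funext => x.
rewrite !exprS; ring.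
Qed.

Lemma measurable_horner {R : realType} (q : {poly R}) (F : R -> R) :
  measurable_fun setT F -> measurable_fun setT (fun x => q.[F x]).
Proof.
move=> mF; under eq_fun do rewrite horner_coef.
by apply: measurable_sum => i; apply: measurable_funM => //; exact: measurable_funX.
Qed.

(** Linearity reduces this to monomials. Integrability is carried along because the coefficients may
    have either sign; the constant term disappears under differentiation, hence [- q.[0]]. *)
Lemma is_density_integral_horner {R : realType} (F f : R -> R) (q : {poly R}) (x : R) :
  is_density F f ->
  (@lebesgue_measure R).-integrable `]-oo, x] (fun y => (q^`().[F y] * f y)%:E) /\
  (\int[@lebesgue_measure R]_(y in `]-oo, x]) (q^`().[F y] * f y)%:E)%E =
    (q.[F x] - q.[0])%:E.
Proof.
move=> Ff; rewrite -[q]coefK poly_def.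
pose K (q : {poly R}) := (@lebesgue_measure R).-integrable `]-oo, x]
    (fun y => (q^`().[F y] * f y)%:E) /\
  (\int[@lebesgue_measure R]_(y in `]-oo, x]) (q^`().[F y] * f y)%:E)%E =
    (q.[F x] - q.[0])%:E.
rewrite -/(K _); apply: (big_ind K) => [|p r [ip Ip] [ir Ir]|i _].
- have -> : K 0 = K 0%:P by [].
  rewrite /K (_ : (fun y => (0%:P^`().[F y] * f y)%:E) = cst 0%E); last first.
    by apply/funext => y; rewrite derivC horner0 mul0r.
  by split; [exact: integrable0|rewrite integral0 !horner0 subrr].
- rewrite /K (_ : (fun y => ((p + r)^`().[F y] * f y)%:E) =
    (fun y => (p^`().[F y] * f y)%:E + (r^`().[F y] * f y)%:E)%E); last first.
    by apply/funext => y; rewrite derivD hornerD mulrDl EFinD.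
  split; first exact: integrableD.
  rewrite integralD//= Ip Ir -EFinD !hornerD.
  by congr EFin; ring.
- case: i => -[|n] /= _.
    rewrite /K (_ : (fun y => _) = cst 0%E); last first.
      by apply/funext => y; rewrite derivZ derivXn mulr0n scaler0 horner0 mul0r.
    split; first exact: integrable0.
    by rewrite integral0 !hornerE subrr.
  have Fn := is_density_exp _ _ n Ff.
  rewrite /K (_ : (fun y => _) =
      fun y => ((q`_n.+1)%:E * (n.+1%:R * F y ^+ n * f y)%:E)%E); last first.
    apply/funext => y.
    rewrite derivZ derivXn -EFinM hornerZ hornerMn hornerXn -[_ *+ n.+1]mulr_natl.
    by congr EFin; rewrite /=; ring.
  have iF := is_density_integrable _ _ Fn x.
  split; first exact: integrableZl.
  rewrite integralZl//=; have [_ _ <-] := Fn.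
  by rewrite -EFinM !hornerE expr0n/= mulr0 subr0.
Qed.

Lemma is_density_horner {R : realType} (F f : R -> R) (q : {poly R}) :
  is_density F f -> (forall x, F x <= 1) ->
  (forall t, 0 <= t <= 1 -> 0 <= q^`().[t]) ->
  is_density (fun x => q.[F x] - q.[0]) (fun x => q^`().[F x] * f x).
Proof.
move=> Ff F1 q0; have [mf f0 _] := Ff; split.
- apply: measurable_funM => //; apply: measurable_horner.
  exact: is_density_measurable Ff.
- by move=> x; rewrite mulr_ge0// q0// F1 (is_density_ge0 _ _ Ff).
- by move=> x; have [_ ->] := is_density_integral_horner _ _ q x Ff.
Qed.

(** * Binomial tails and order statistics of a fixed sample size *)

(** Evaluated at a real [t] in [[0, 1]], this is the probability of at least [i] successes in [n]
    trials of success probability [t]. *)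
Definition binomial_tail (R : comNzRingType) (i n : nat) : {poly R} :=
  \sum_(i <= j < n.+1) 'C(n, j)%:R *: ('X^j * (1 - 'X) ^+ (n - j)).

Lemma order_stat_cdfE {R : realType} (F : R -> R) (i n : nat) (x : R) :
  order_stat_cdf F i n x = (binomial_tail R i n).[F x].
Proof.
rewrite /order_stat_cdf /binomial_tail horner_sum; apply: eq_bigr => j _.
by rewrite !hornerE.
Qed.

Lemma binomial_tail0 (R : comNzRingType) (i n : nat) :
  (0 < i)%N -> (binomial_tail R i n).[0] = 0.
Proof.
move=> i0; rewrite /binomial_tail horner_sum big_nat_cond big1// => j /andP[/andP[ij _] _].
by rewrite !hornerE expr0n gtn_eqF ?(leq_trans i0)//= mulr0 mul0r.
Qed.

(* The derivatives of the summands telescope. *)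
Lemma deriv_binomial_tail (R : comNzRingType) (i n : nat) : (i <= n.+1)%N ->
  (binomial_tail R i.+1 n.+1)^`() =
    (n.+1 * 'C(n, i))%:R *: ('X^i * (1 - 'X) ^+ (n - i)).
Proof.
move=> ni; rewrite /binomial_tail.
(* Summand [j.+1] has derivative [T j - T j.+1], and the last term [T n.+1] vanishes with its
   binomial coefficient; only [T i] survives. *)
pose T j : {poly R} := (n.+1 * 'C(n, j))%:R *: ('X^j * (1 - 'X) ^+ (n - j)).
transitivity (\sum_(i <= j < n.+1) (- T j.+1 - - T j)); last first.
  by rewrite (telescope_sumr (fun j => - T j))// {1}/T bin_small// muln0 scale0r oppr0 sub0r opprK.
rewrite big_add1 raddf_sum; apply: eq_bigr => j _ /=.
rewrite /T derivZ derivM derivXn deriv_exp (derivB 1 'X) derivX -polyC1 derivC sub0r.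
rewrite (mul_bin_diag n.+1 j) (mul_bin_down n.+1 j.+1) subSS subnS.
rewrite /= !natrM -!mul_polyC !polyCM !polyC_natr polyC1.
ring.
Qed.

Lemma sum_binomial_term (R : comNzRingType) (n : nat) (t : R) :
  \sum_(0 <= j < n.+1) 'C(n, j)%:R * t ^+ j * (1 - t) ^+ (n - j) = 1.
Proof.
have := exprDn (1 - t) t n; rewrite subrK expr1n big_mkord => E; rewrite [RHS]E.
by apply: eq_bigr => j _; ring.
Qed.

(** A tail of the nonnegative binomial terms, whose full sum is 1. *)
Lemma order_stat_cdf_bounds {R : realType} (F : R -> R) (i n : nat) (x : R) :
  0 <= F x <= 1 -> 0 <= order_stat_cdf F i n x <= 1.
Proof.
move=> /andP[F0 F1]; have T0 j : 0 <= 'C(n, j)%:R * F x ^+ j * (1 - F x) ^+ (n - j).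
  by rewrite !mulr_ge0// exprn_ge0// subr_ge0.
apply/andP; split; first by apply: sumr_ge0.
rewrite /order_stat_cdf; have [ni|ni] := leqP n.+1 i; first by rewrite big_geq.
rewrite -[leRHS](sum_binomial_term _ n (F x)) [leRHS](@big_cat_nat _ _ _ i)//=; last exact: ltnW.
by rewrite lerDr sumr_ge0.
Qed.

Lemma order_stat_cdf_small {R : realType} (F : R -> R) (i n : nat) (x : R) :
  (n < i)%N -> order_stat_cdf F i n x = 0.
Proof. by move=> ni; rewrite /order_stat_cdf big_geq. Qed.

(** * Termwise differentiation of power series *)

(** The power function lies above its tangent at [K]. The bound absorbs the factor [n.+1] of a
    formal derivative into a slightly larger radius. *)
Lemma mulrn_exp_le {R : realFieldType} (K L : R) (n : nat) : 0 <= K <= L ->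
  n.+1%:R * K ^+ n * (L - K) <= L ^+ n.+1.
Proof.
move=> /andP[K0 KL]; have L0 := le_trans K0 KL.
elim: n => [|n IH]; first by rewrite expr0 expr1 !mul1r gerBl.
rewrite -natr1 [leRHS](_ : _ = K * L ^+ n.+1 + L ^+ n.+1 * (L - K)); last first.
  by rewrite [in LHS]exprS; ring.
rewrite mulrDl mul1r mulrDl lerD//; last by rewrite ler_wpM2r ?subr_ge0// lerXn2r.
rewrite exprS [leLHS](_ : _ = K * (n.+1%:R * K ^+ n * (L - K))); last by ring.
by rewrite ler_wpM2l.
Qed.

(** Comparison with the absolutely convergent series at the intermediate radius [L], at the cost of
    the constant factor [(L - |z|)^-1]. *)
Lemma is_cvg_pseries_diffs_inside {R : realType} (c : R^nat) (x z : R) :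
  cvgn (pseries c x) -> `|z| < `|x| -> cvgn (pseries (pseries_diffs c) z).
Proof.
move=> cx zx; pose L := (`|z| + `|x|) / 2.
have zL : `|z| < L by rewrite /L; lra.
have Lx : L < `|x| by rewrite /L; lra.
have L0 : 0 < L by rewrite (le_lt_trans _ zL).
have cL : cvgn (pseries (fun i => `|c i|) L).
  by apply: is_cvg_pseries_inside_norm cx _; rewrite ger0_norm// ltW.
apply: normed_cvg.
apply: (@series_le_cvg _ _ (fun n => (L - `|z|)^-1 * (`|c n.+1| * L ^+ n.+1))) => //.
- by move=> n /=.
- move=> n; rewrite mulr_ge0 ?invr_ge0 ?subr_ge0 ?(ltW zL)//.
  by rewrite mulr_ge0// exprn_ge0// ltW.
- move=> n; rewrite /= /pseries_diffs !normrM normrX normr_nat.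
  rewrite [leRHS]mulrC ler_pdivlMr ?subr_gt0//.
  rewrite [leLHS](_ : _ = `|c n.+1| * (n.+1%:R * `|z| ^+ n * (L - `|z|))); last by ring.
  by rewrite ler_wpM2l// mulrn_exp_le// normr_ge0 ltW.
apply: (@is_cvg_seriesZ R (fun n => `|c n.+1| * L ^+ n.+1)).
have -> : series (fun n => `|c n.+1| * L ^+ n.+1) =
    (fun n => pseries (fun i => `|c i|) L n.+1 - `|c 0%N|).
  apply/funext => n; rewrite /pseries /series /= big_nat_recl// expr0 mulr1.
  by rewrite addrC addKr.
apply: is_cvgB; last exact: is_cvg_cst.
by apply/cvg_ex; exists (limn (pseries (fun i => `|c i|) L)); rewrite cvg_shiftS.
Qed.

(** [pseries_snd_diffs] asks for the series and its first two formal derivatives to converge at some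
    [L] beyond [|x|]. Each formal derivative costs some radius, whence the chain
    [|x| < L < M < |K|]. *)
Lemma is_derive_pseries {R : realType} (c : R^nat) (K x : R) :
  cvgn (pseries c K) -> `|x| < `|K| ->
  is_derive x (1 : R) (fun x => limn (pseries c x)) (limn (pseries (pseries_diffs c) x)).
Proof.
move=> cK xK; pose L := (`|x| + `|K|) / 2; pose M := (L + `|K|) / 2.
have xL : `|x| < L by rewrite /L; lra.
have LK : L < `|K| by rewrite /L; lra.
have LM : L < M by rewrite /M; lra.
have MK : M < `|K| by rewrite /M; lra.
have L0 : 0 <= L by rewrite (le_trans _ (ltW xL)).
have M0 : 0 <= M by rewrite (le_trans L0)// ltW.
have d1 : cvgn (pseries (pseries_diffs c) M).
  by apply: is_cvg_pseries_diffs_inside cK _; rewrite ger0_norm.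
apply: (@pseries_snd_diffs _ _ L).
- by apply: is_cvg_pseries_inside cK _; rewrite ger0_norm.
- by apply: is_cvg_pseries_inside d1 _; rewrite !ger0_norm.
- by apply: is_cvg_pseries_diffs_inside d1 _; rewrite !ger0_norm.
- by rewrite (ger0_norm L0).
Qed.

(** Convergence passes to a formal derivative at any strictly smaller radius; the midpoint of [|x|]
    and 1 leaves room at every step. *)
Lemma is_cvg_pseries_iter_diffs {R : realType} (c : R^nat) (i : nat) :
  (forall K, 0 <= K < 1 -> cvgn (pseries c K)) ->
  forall x, `|x| < 1 -> cvgn (pseries (iter i (@pseries_diffs R) c) x).
Proof.
move=> cK; elim: i => [|i IH] x x1 /=.
  apply: (@is_cvg_pseries_inside _ _ ((`|x| + 1) / 2)).
    by apply: cK; apply/andP; split; have := normr_ge0 x; lra.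
  by rewrite [ltRHS]ger0_norm; have := normr_ge0 x; lra.
have y0 : 0 <= (`|x| + 1) / 2 by have := normr_ge0 x; lra.
apply: (@is_cvg_pseries_diffs_inside _ _ ((`|x| + 1) / 2)).
  by apply: IH; rewrite ger0_norm//; lra.
by rewrite [ltRHS]ger0_norm//; lra.
Qed.

(** Each derivative contributes a factor [-1] from [1 - t]. The condition on [t] is open, so the
    induction hypothesis holds near [t] and can be differentiated. *)
Lemma derive1n_pseries_onem {R : realType} (c : R^nat) (i : nat) :
  (forall K, 0 <= K < 1 -> cvgn (pseries c K)) ->
  forall t, `|1 - t| < 1 ->
  derive1n i (fun t => limn (pseries c (1 - t))) t =
    (-1) ^+ i * limn (pseries (iter i (@pseries_diffs R) c) (1 - t)).
Proof.
move=> cK; elim: i => [|i IH] t t1; first by rewrite expr0 mul1r.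
rewrite derive1nS derive1E.
rewrite (@near_eq_derive R R R _ (fun t : R => (-1) ^+ i *
    limn (pseries (iter i (@pseries_diffs R) c) (1 - t)))); last first.
  have : \near t, `|1 - t| < 1.
    have cn : continuous (fun t : R => `|1 - t|).
      move=> y; apply: cvg_norm; apply: cvgB; [exact: cvg_cst|exact: cvg_id].
    exact: (cvgr_lt _ (cn t) _ t1).
  by apply: filterS => s s1; exact: IH.
set h := iter i _ c.
have D : is_derive (1 - t) (1 : R) (fun x => limn (pseries h x))
    (limn (pseries (pseries_diffs h) (1 - t))).
  have y0 : 0 <= (`|1 - t| + 1) / 2 by have := normr_ge0 (1 - t); lra.
  apply: (@is_derive_pseries _ _ ((`|1 - t| + 1) / 2)).
    by apply: is_cvg_pseries_iter_diffs => //; rewrite ger0_norm//; lra.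
  by rewrite [ltRHS]ger0_norm//; lra.
have D1 : is_derive t (1 : R) (fun t : R => 1 - t) (-1).
  by rewrite -[- 1]sub0r; apply: is_deriveB.
have D2 := @is_derive1_comp R (fun x => limn (pseries h x)) (fun t : R => 1 - t) t _ _ D D1.
have D3 : is_derive t (1 : R) (fun t => (-1) ^+ i * limn (pseries h (1 - t)))
    ((-1) ^+ i *: (limn (pseries (pseries_diffs h) (1 - t)) * (-1))).
  exact: is_deriveZ.
by rewrite derive_val exprS /GRing.scale/=; ring.
Qed.

Lemma iter_pseries_diffsE {R : realType} (c : R^nat) (i n : nat) :
  iter i (@pseries_diffs R) c n = ((n + i) ^_ i)%:R * c (n + i)%N.
Proof.
elim: i n => [|i IH] n; first by rewrite addn0 ffactn0 mul1r.
rewrite iterS {1}/pseries_diffs IH addSnnS ffactnSr mulrA -natrM.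
by rewrite mulnC addnS subSn ?leq_addl// addnK.
Qed.

(** * The mass function of [N] and its Laplace transform *)

Lemma lim_shiftn {V : ptopologicalType} (k : nat) (u : V^nat) :
  limn (fun n => u (n + k)%N) = limn u.
Proof.
(* [limn] is a choice from the set of limits, and a shift preserves that set, so the equality covers
   divergent sequences too. *)
congr (get _); apply/funext => l; exact: (cvg_shiftn k u).
Qed.

Section probability_mass.
Context {d} {T : measurableType d} {R : realType} {P : probability T R}.
Variable N : {RV P >-> nat}.

Lemma measurable_rv_nat (A : set nat) : measurable [set w | A (N w)].
Proof. by apply: (measurable_funPTI N (Y := A)). Qed.

Lemma prob_eq_ge0 (k : nat) : 0 <= prob_eq N k.
Proof. exact/fine_ge0/measure_ge0. Qed.

(** The events are pairwise disjoint, so the sum is the probability of their union. *)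
Lemma sum_prob_eq_le1 (n : nat) : \sum_(0 <= k < n) prob_eq N k.+1 <= 1.
Proof.
rewrite -lee_fin -sumEFin big_mkord.
have E (k : 'I_n) : (prob_eq N k.+1)%:E = P [set w | N w = k.+1].
  by rewrite fineK// fin_num_measure//; exact: (measurable_rv_nat [set k.+1 : nat]).
under eq_bigr do rewrite E.
rewrite -(measure_bigsetU P (F := fun k => [set w | N w = k.+1])).
- apply: probability_le1; apply: bigsetU_measurable => i _.
  exact: (measurable_rv_nat [set i.+1 : nat]).
- by move=> i; exact: (measurable_rv_nat [set i.+1 : nat]).
- by move=> i j _ _ [w [/= -> []]].
Qed.

(** Since [rho k <= k], the event of positive probability lies inside [N >= i]; this makes the
    normalising factor invertible. *)
Lemma prob_ge_gt0 (i : nat) :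
  (0 < P [set w | (i <= rho (N w))%N])%E -> 0 < prob_ge N i.
Proof.
move=> Pi; rewrite -lte_fin fineK; last first.
  by apply: fin_num_measure; exact: (measurable_rv_nat [set k | (i <= k)%N]).
apply: (lt_le_trans Pi); apply: le_measure; rewrite ?inE.
- exact: (measurable_rv_nat [set k | (i <= rho k)%N]).
- exact: (measurable_rv_nat [set k | (i <= k)%N]).
- by move=> w /= /leq_trans; apply; exact: leq_subr.
Qed.

(** Domination by the total mass reaches the endpoint [K = 1], which is the point [t = 0] of the
    transform. *)
Lemma is_cvg_pseries_prob_eq (K : R) : 0 <= K <= 1 ->
  cvgn (pseries (fun k => prob_eq N k.+1) K).
Proof.
move=> /andP[K0 K1].
have c0 k : 0 <= prob_eq N k.+1 * K ^+ k by rewrite mulr_ge0 ?exprn_ge0// prob_eq_ge0.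
apply: nondecreasing_is_cvgn; first by apply: nondecreasing_series => n _ _; exact: c0.
exists 1 => _ [n _ <-]; apply: le_trans (sum_prob_eq_le1 n).
apply: ler_sum => k _; rewrite ler_piMr ?prob_eq_ge0// exprn_ile1//.
Qed.

Lemma nabla_laplaceE (t : R) :
  nabla_laplace N t = limn (pseries (fun k => prob_eq N k.+1) (1 - t)).
Proof.
rewrite /nabla_laplace -(lim_shiftn 1); congr (limn _); apply/funext => n.
rewrite addn1 big_add1 /pseries /series/=; apply: eq_bigr => k _.
by rewrite subn1 mulrC.
Qed.

(** This maximum at 0 fixes the sign of the first derivative there. *)
Lemma nabla_laplace_le (t : R) : 0 <= t <= 1 -> nabla_laplace N t <= nabla_laplace N 0.
Proof.
move=> /andP[t0 t1]; rewrite !nabla_laplaceE.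
apply: lim_series_le.
- by apply: is_cvg_pseries_prob_eq; apply/andP; split; lra.
- by apply: is_cvg_pseries_prob_eq; apply/andP; split; lra.
move=> k; rewrite ler_wpM2l ?prob_eq_ge0// subr0 expr1n exprn_ile1//; lra.
Qed.

End probability_mass.

(** * Behaviour where [F] vanishes *)

(* Where the derivative does not exist, [derive1] takes the default value [0]. *)
Lemma derive1_le0_of_right {R : realType} (L : R -> R) (a b : R) : a < b ->
  (forall t, a < t < b -> L t <= L a) -> derive1 L a <= 0.
Proof.
move=> ab Lt; rewrite /derive1.
set q := fun h => _.
have [cq|ncq] := pselect (cvg (q h @[h --> 0^'])); last first.
  rewrite [leLHS](_ : _ = point)//; apply: getPN => l ql; apply: ncq.
  by apply/cvg_ex; exists l.
(* An existing two-sided limit is also the right-hand limit, along which the quotients are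
   nonpositive. *)
rewrite cvg_at_rightE//; apply: limr_le.
  by apply/cvg_ex; exists (lim (q h @[h --> 0^'])); exact: cvg_dnbhs_at_right.
near=> h; have h0 : 0 < h by [].
have hb : h < b - a by near: h; apply: nbhs_right_lt; rewrite subr_gt0.
rewrite /q /GRing.scale/= mulr_ge0_le0 ?invr_ge0 ?(ltW h0)// subr_le0 Lt//; lra.
Unshelve. all: by end_near.
Qed.

Lemma cumulativeBounded_le1 {R : realType} (F : cumulativeBounded (0 : R) (1 : R)) (x : R) :
  F x <= 1.
Proof.
have F1 := cumulativey F; rewrite -[leRHS](cvg_lim _ F1)//; apply: limr_ge.
  by apply/cvg_ex; exists 1.
near=> y; apply: cumulative_is_nondecreasing; near: y; exact: nbhs_pinfty_ge.
Unshelve. all: by end_near.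
Qed.

(* Integrating [(1 - F) ^+ n * f] bounds the integral of [f] over [F = 0] by [n.+1^-1]. *)
Lemma is_density_eq0 {R : realType} (F f : R -> R) (x : R) :
  is_density F f -> (forall y, F y <= 1) ->
  {ae @lebesgue_measure R, forall y, `]-oo, x]%classic y -> F y = 0 -> f y = 0}.
Proof.
move=> Ff F1; have [mf f0 _] := Ff; have F0 := is_density_ge0 _ _ Ff.
have mF := is_density_measurable _ _ setT Ff.
pose g y := f y * (F y == 0)%:R.
have g0 y : 0 <= g y by rewrite mulr_ge0.
have mg : measurable_fun setT g.
  apply: measurable_funM => //.
  rewrite (_ : (fun y => _) = fun y => if F y == 0 then 1 else 0); last first.
    by apply/funext => y; case: eqP.
  by apply: measurable_fun_ifT => //; exact: measurable_fun_eqr.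
have mgE : measurable_fun `]-oo, x] (EFin \o g).
  by apply/measurable_EFinP; exact: measurable_funTS.
pose I := (\int[@lebesgue_measure R]_(y in `]-oo, x]) (g y)%:E)%E.
have I0 : (0 <= I)%E by apply: integral_ge0 => y _; rewrite lee_fin.
have In n : (I <= (n.+1%:R^-1)%:E)%E.
  (* [q] is the antiderivative of [(1 - t) ^+ n] vanishing at 0; the integrand equals 1 at [t = 0],
     while [q] stays below [n.+1^-1] on [[0, 1]]. *)
  pose q : {poly R} := n.+1%:R^-1 *: (1 - (1 - 'X) ^+ n.+1).
  have dq : q^`() = (1 - 'X) ^+ n.
    rewrite /q derivZ derivB deriv_exp derivB derivX -polyC1 derivC !sub0r.
    rewrite mulN1r mulNrn opprK -[_ ^+ _ *+ _]scaler_nat scalerA mulVf ?scale1r// pnatr_eq0.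
  have [iq Iq] := is_density_integral_horner _ _ q x Ff.
  apply: (@le_trans _ _ (\int[@lebesgue_measure R]_(y in `]-oo, x]) (q^`().[F y] * f y)%:E)%E).
    apply: ge0_le_integral => //=.
    - by move=> y _; rewrite lee_fin.
    - by have /integrableP[] := iq.
    - move=> y _; rewrite lee_fin dq !hornerE /g.
      case: eqP => [->|_]; first by rewrite subr0 expr1n mulr1 mul1r.
      by rewrite mulr0 mulr_ge0// exprn_ge0// subr_ge0.
  rewrite Iq lee_fin /q !hornerE subr0 expr1n subrr mulr0 subr0.
  by rewrite ler_piMr ?invr_ge0// gerBl exprn_ge0// subr_ge0.
have : I = 0%E.
  apply/eqP; rewrite eq_le I0 andbT; apply/lee_addgt0Pr => e e0; rewrite add0e.
  apply: (le_trans (In (Num.bound e^-1))); rewrite lee_fin invf_ple ?posrE//.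
  rewrite (le_trans (ltW (archi_boundP _)))// ?invr_ge0 ?(ltW e0)//.
  by rewrite ler_nat.
move=> I00; have Ig : (\int[@lebesgue_measure R]_(y in `]-oo, x]) `|(EFin \o g) y|)%E = 0%E.
  by rewrite -I00; apply: eq_integral => y _; rewrite /= ger0_norm.
have := (ae_eq_integral_abs lebesgue_measure (measurable_itv _) mgE).1 Ig.
apply: filterS => y gy xy Fy.
by have [] := gy xy; rewrite /g Fy eqxx mulr1.
Qed.

(** * The series over the values of [N] *)

Section random_order_stat.
Context {d} {T : measurableType d} {R : realType} {P : probability T R}.
Variables (N : {RV P >-> nat}) (j : nat).

(** With [i = j.+1] and sample size [(m + j).+1], the exponent of [1 - t] is [m], and the falling
    factorial is the coefficient produced by [j.+1] formal derivatives. *)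
Lemma horner_deriv_binomial_tail (m : nat) (t : R) :
  (binomial_tail R j.+1 (m + j).+1)^`().[t] =
    t ^+ j / j`!%:R * ((m + j.+1) ^_ j.+1)%:R * (1 - t) ^+ m.
Proof.
have j0 : j`!%:R != 0 :> R by rewrite pnatr_eq0 -lt0n fact_gt0.
rewrite deriv_binomial_tail ?(leq_trans (leq_addl m j))// !hornerE addnK addnS ffactSS.
by rewrite -bin_ffact !natrM /=; field.
Qed.

Lemma deriv_binomial_tail_ge0 (m : nat) (t : R) : 0 <= t <= 1 ->
  0 <= (binomial_tail R j.+1 (m + j).+1)^`().[t].
Proof.
move=> /andP[t0 t1]; rewrite horner_deriv_binomial_tail.
by rewrite !mulr_ge0 ?invr_ge0 ?exprn_ge0// subr_ge0.
Qed.

(** Up to the factor [t ^+ j / j!], this is the [j.+1]-st formal derivative of the Laplace series at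
    [1 - t]; [t > 0] puts that point inside the open unit disc. *)
Lemma cvg_deriv_binomial_tail (t : R) : 0 < t <= 1 ->
  series (fun m => (binomial_tail R j.+1 (m + j).+1)^`().[t] * prob_eq N (m + j).+2)
    @ \oo -->
  (-1) ^+ j.+1 * t ^+ j / j`!%:R * derive1n j.+1 (nabla_laplace N) t.
Proof.
move=> /andP[t0 t1]; pose c k := prob_eq N k.+1.
have cK K : 0 <= K < 1 -> cvgn (pseries c K).
  by move=> /andP[K0 K1]; apply: is_cvg_pseries_prob_eq; rewrite K0 ltW.
have t1' : `|1 - t| < 1 by rewrite ger0_norm; lra.
rewrite (_ : nabla_laplace N = fun t => limn (pseries c (1 - t))); last first.
  by apply/funext => s; rewrite nabla_laplaceE.
rewrite derive1n_pseries_onem//.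
set D := iter _ _ _.
rewrite [X in _ --> X](_ : _ = t ^+ j / j`!%:R * limn (pseries D (1 - t))); last first.
  (* The sign in the formula cancels the sign from differentiating in [1 - t]. *)
  have := sqrr_sign R j.+1; move: ((-1) ^+ j.+1) => s s2.
  by rewrite -[RHS]mul1r -s2; ring.
have -> : series (fun m => (binomial_tail R j.+1 (m + j).+1)^`().[t] * prob_eq N (m + j).+2)
    = fun n => t ^+ j / j`!%:R * pseries D (1 - t) n.
  apply/funext => n; rewrite /pseries /series/= mulr_sumr; apply: eq_bigr => m _.
  by rewrite horner_deriv_binomial_tail /D iter_pseries_diffsE /c addnS; ring.
apply: cvgM; first exact: cvg_cst.
exact: is_cvg_pseries_iter_diffs.
Qed.

Lemma is_cvg_binomial_tail_series (t : R) : 0 <= t <= 1 ->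
  cvgn (series (fun m => (binomial_tail R j.+1 (m + j).+1).[t] * prob_eq N (m + j).+2)).
Proof.
(* Taking [id] as the distribution function turns the bounds at [F x] into bounds at [t]. *)
move=> t01; have B m := order_stat_cdf_bounds id j.+1 (m + j).+1 t t01.
have B0 m : 0 <= (binomial_tail R j.+1 (m + j).+1).[t] * prob_eq N (m + j).+2.
  by have /andP[B0 _] := B m; rewrite mulr_ge0 ?prob_eq_ge0// -(order_stat_cdfE id).
apply: nondecreasing_is_cvgn; first by apply: nondecreasing_series => n _ _; exact: B0.
exists 1 => _ [n _ <-]; apply: le_trans (sum_prob_eq_le1 N (n + j.+1)).
rewrite [leRHS](@big_cat_nat _ _ _ j.+1)//= ?leq_addl// ler_wpDl//.
  by apply: sumr_ge0 => k _; exact: prob_eq_ge0.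
rewrite -{2}[j.+1]add0n big_addn addnK; apply: ler_sum => m _.
rewrite addnS ler_piMl ?prob_eq_ge0//.
by have /andP[_] := B m; rewrite order_stat_cdfE.
Qed.

Lemma random_order_stat_cdfE (F : R -> R) (x : R) :
  random_order_stat_cdf F N j.+1 x = (prob_ge N j.+1)^-1 *
    limn (series (fun m => (binomial_tail R j.+1 (m + j).+1).[F x] * prob_eq N (m + j).+2)).
Proof.
rewrite /random_order_stat_cdf -(lim_shiftn j.+2); congr (_ * _); congr (limn _); apply/funext => n.
(* The value [N = j.+1] gives a sample of size [j], too small for the order statistic, so the series
   really starts at [j.+2]. *)
rewrite big_ltn ?leq_addl// order_stat_cdf_small; last by rewrite /rho subn1.
rewrite mul0r add0r -{1}[j.+2]add0n big_addn addnK; apply: eq_bigr => m _.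
by rewrite order_stat_cdfE /rho subn1 !addnS.
Qed.

End random_order_stat.

(** * Assembly of the density *)

Lemma eseries_EFin {R : realType} (u : R^nat) (l : R) :
  series u @ \oo --> l -> (\sum_(m <oo) (u m)%:E)%E = l%:E.
Proof.
move=> ul; rewrite -(cvg_lim _ ul)// -EFin_lim; last by apply/cvg_ex; exists l.
by congr (limn _); apply/funext => n; rewrite sumEFin.
Qed.

Theorem mainTheorem2 (R : realType) (F : cumulativeBounded (0 : R) (1 : R))
    (f : R -> R) (d : measure_display) (T : measurableType d)
    (P : probability T R) (N : {RV P >-> nat}) (i : nat)
    (hf : is_density F f)
    (hN : forall w, (1 <= N w)%N)
    (hi : (1 <= i)%N)
    (hNi : (0 < P [set w | (i <= rho (N w))%N])%E) :
  let rhs (x : R) : R :=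
    (-1) ^+ i * F x ^+ (i - 1)%N * f x
      / (prob_ge N i * ((i - 1)`!)%:R)
      * derive1n i (nabla_laplace N) (F x) in
  is_density (random_order_stat_cdf F N i) rhs /\
  (forall g : R -> R, is_density (random_order_stat_cdf F N i) g ->
     {ae @lebesgue_measure R, forall x, g x = rhs x}).
Proof.
move=> rhs; suff D : is_density (random_order_stat_cdf F N i) rhs.
  by split=> // g Dg; exact: is_density_ae_unique Dg D.
have pi0 := prob_ge_gt0 N i hNi.
case: i => [//|j] in hi hNi rhs pi0 *.
have [mf f0 _] := hf.
have F1 := cumulativeBounded_le1 F.
have F0 := is_density_ge0 _ _ hf.
have mF := is_density_measurable _ _ setT hf.
set p := prob_ge N j.+1 in pi0 *.
pose B m : {poly R} := binomial_tail R j.+1 (m + j).+1.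
pose c m := p^-1 * prob_eq N (m + j).+2.
have c0 m : 0 <= c m by rewrite mulr_ge0 ?prob_eq_ge0// invr_ge0 ltW.
have BD m : is_density (fun x => (B m).[F x]) (fun x => (B m)^`().[F x] * f x).
  have := is_density_horner _ _ (B m) hf F1 (deriv_binomial_tail_ge0 _ m).
  by under eq_fun do rewrite binomial_tail0// subr0.
pose h m y := c m * ((B m)^`().[F y] * f y).
have h0 m y : 0 <= h m y by have [_ ? _] := BD m; rewrite mulr_ge0.
have mh m : measurable_fun setT (EFin \o h m).
  by have [? _ _] := BD m; apply/measurable_EFinP; exact: measurable_funM.
(* [H] is extended-valued: the sum may be infinite where [F y = 0], yet it is measurable and suits
   monotone convergence. *)
pose H y := (\sum_(m <oo) (h m y)%:E)%E.
have mH : measurable_fun setT H.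
  apply: (@ge0_emeasurable_sum _ _ _ setT (fun m y => (h m y)%:E) xpredT).
    by move=> m y _ _; rewrite lee_fin.
  by move=> m _; exact: mh.
have HE y : 0 < F y -> H y = (rhs y)%:E.
  move=> Fy0; apply: eseries_EFin.
  have -> : series (h ^~ y) = fun n => p^-1 * f y *
      series (fun m => (B m)^`().[F y] * prob_eq N (m + j).+2) n.
    apply/funext => n; rewrite /series/= mulr_sumr; apply: eq_bigr => m _.
    by rewrite /h /c; ring.
  have -> : rhs y = p^-1 * f y *
      ((-1) ^+ j.+1 * F y ^+ j / j`!%:R * derive1n j.+1 (nabla_laplace N) (F y)).
    by rewrite /rhs subn1 invfM; ring.
  apply: cvgM; first exact: cvg_cst.
  by apply: cvg_deriv_binomial_tail; rewrite Fy0 F1.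
(* Measurability of [rhs] is read off from this split: a constant multiple of [f] where [F]
   vanishes, and [H] elsewhere. *)
have rhsE y : rhs y = if F y == 0
    then (-1) ^+ j.+1 * 0 ^+ j * f y / (p * j`!%:R) * derive1n j.+1 (nabla_laplace N) 0
    else fine (H y).
  case: eqP => [Fy|/eqP Fy]; first by rewrite /rhs Fy subn1.
  by rewrite HE// lt0r Fy F0.
have rhs0 y : 0 <= rhs y.
  have [Fy|Fy] := eqVneq (F y) 0.
    (* For [j > 0] the factor [0 ^+ j] kills the value; for [j = 0] the sign of the first derivative
       at 0 decides. *)
    rewrite /rhs Fy subn1/=; case: (j) => [|k]; last first.
      by rewrite expr0n mulr0 !mul0r.
    rewrite expr1 expr0 mulr1 mulN1r !mulNr -mulrN mulr_ge0//.
      by rewrite divr_ge0// mulr_ge0//; exact/fine_ge0/measure_ge0.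
    rewrite oppr_ge0; apply: (derive1_le0_of_right _ _ 1) => // t /andP[t0 t1].
    by apply: nabla_laplace_le; rewrite !ltW.
  rewrite rhsE (negbTE Fy); apply: fine_ge0; apply: nneseries_ge0 => m _ _.
  by rewrite lee_fin.
have mrhs : measurable_fun setT rhs.
  rewrite (funext rhsE); apply: measurable_fun_ifT.
  - exact: measurable_fun_eqr.
  - by apply: measurable_funM => //; apply: measurable_funM => //; exact: measurable_funM.
  - exact: (measurableT_comp (f := fine)) mH.
split => // x.
transitivity (\int[@lebesgue_measure R]_(y in `]-oo, x]) H y)%E; last first.
  apply: ge0_ae_eq_integral => //.
  - exact: measurable_funTS.
  - by apply/measurable_EFinP; exact: measurable_funTS.
  - by move=> y _; apply: nneseries_ge0 => m _ _; rewrite lee_fin.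
  - by move=> y _; rewrite lee_fin.
  (* Almost everywhere on [F = 0] the density [f] vanishes, and [rhs] and [H] with it. *)
  - have := is_density_eq0 _ _ x hf F1; apply: filterS.
      exact: (ae_filter_ringOfSetsType lebesgue_measure).
    move=> y fy xy.
    have [Fy|Fy] := eqVneq (F y) 0; last by rewrite HE// lt0r Fy F0.
    rewrite /rhs (fy xy Fy) mulr0 !mul0r /H eseries0// => m _ _.
    by rewrite /h (fy xy Fy) !mulr0.
(* Monotone convergence exchanges sum and integral; each term then integrates to a weighted
   fixed-size distribution function. *)
rewrite integral_nneseries//; last 2 first.
- by move=> m; apply: measurable_funTS; exact: mh.
- by move=> m y _; rewrite lee_fin.
have hI m : (\int[@lebesgue_measure R]_(y in `]-oo, x]) (h m y)%:E =
    (p^-1 * ((B m).[F x] * prob_eq N (m + j).+2))%:E)%E.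
  have [mBm BD0 BDI] := BD m.
  under eq_integral do rewrite /h EFinM.
  rewrite ge0_integralZl//=; last 3 first.
  - by apply/measurable_EFinP; exact: measurable_funTS.
  - by move=> y _; rewrite lee_fin.
  - by rewrite lee_fin.
  by rewrite -BDI -EFinM /c; congr EFin; ring.
rewrite (eq_eseriesr (fun m _ => hI m)) random_order_stat_cdfE; apply/esym/eseries_EFin.
rewrite (_ : series _ = fun n => p^-1 *
    series (fun m => (B m).[F x] * prob_eq N (m + j).+2) n); last first.
  by apply/funext => n; rewrite /series/= mulr_sumr.
apply: cvgM; first exact: cvg_cst.
by apply: is_cvg_binomial_tail_series; rewrite F0 F1.
Qed.
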